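(* Let $\mathcal T$ be a balanced factorization category and let $X$ be an object of $\mathcal T$. Then $X$ is locally simply connected, i.e. for every point $x:1\to X$ the object $X/x$ is simply connected; and every finite covering $b\in\mathcal B/X$ is locally trivial: for every point $x:1\to X$, pulling back $b$ along $X/x\to X$ one gets a constant covering, i.e. an object of $\mathcal B/(X/x)$ isomorphic to $!_{X/x}^*S$ for some finite set $S\in\mathcal B/1$.
   Context: A balanced factorization category is a finitely complete category $\mathcal T$ with two (orthogonal) factorization systems $(\mathcal E,\mathcal M)$ and $(\mathcal E',\mathcal M')$ satisfying the reciprocal stability law: the pullback of a map in $\mathcal E$ along a map in $\mathcal M'$ is in $\mathcal E$, and the pullback of a map in $\mathcal E'$ along a map in $\mathcal M$ is in $\mathcal E'$. (It is not required that $\mathcal M/1=\mathcal M'/1$.) Let $\mathcal B:=\mathcal M\cap\mathcal M'$, the class of finite coverings, and let $\mathcal B/X$ be the full subcategory of $\mathcal T/X$ on the objects lying in $\mathcal B$. Objects of $\mathcal B/1$ are called finite sets. For a point $x:1\to X$, the map $X/x\to X$ is the second factor of an $(\mathcal E,\mathcal M)$-factorization $1\to X/x\to X$ of $x$. For an object $I$, $!_I:I\to1$ is the unique map, and $I$ is simply connected if the pullback functor $!_I^*:\mathcal B/1\to\mathcal B/I$ is an equivalence. *)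

(* Defs.v *)
From mathcomp Require Import all_boot.
From mathcomp Require Import boolp classical_sets cardinality.

Set Implicit Arguments.
Unset Strict Implicit.
Unset Printing Implicit Defensive.

Declare Scope cat_scope.
Delimit Scope cat_scope with cat.

Record category := Category {
  obj :> Type;
  hom : obj -> obj -> Type;
  idm : forall a, hom a a;
  comp : forall a b c, hom b c -> hom a b -> hom a c;
  comp1m : forall a b (f : hom a b), comp (idm b) f = f;
  compm1 : forall a b (f : hom a b), comp f (idm a) = f;
  compA : forall a b c d (h : hom c d) (g : hom b c) (f : hom a b),
    comp h (comp g f) = comp (comp h g) f
}.
Arguments hom {C} a b : rename.
Arguments idm {C} a : rename.
Arguments comp {C a b c} _ _ : rename.

Notation "g \o f" := (comp g f) : cat_scope.
Local Open Scope cat_scope.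

Definition is_iso (C : category) (a b : C) (f : hom a b) : Prop :=
  exists g : hom b a, g \o f = idm a /\ f \o g = idm b.

Definition isomorphic (C : category) (a b : C) : Prop :=
  exists f : hom a b, is_iso f.

Record functor (C D : category) := Functor {
  fobj :> C -> D;
  fmap : forall a b, hom a b -> hom (fobj a) (fobj b);
  fmap1 : forall a, fmap (idm a) = idm (fobj a);
  fmapM : forall a b c (g : hom b c) (f : hom a b),
    fmap (g \o f) = fmap g \o fmap f
}.
Arguments fmap {C D} F {a b} : rename.

Definition id_functor (C : category) : functor C C :=
  @Functor C C (fun a => a) (fun _ _ f => f)
    (fun _ => erefl) (fun _ _ _ _ _ => erefl).

Section CompFunctor.
Variables (C D E : category) (G : functor D E) (F : functor C D).

Fact comp_functor1 (a : C) : fmap G (fmap F (idm a)) = idm (G (F a)).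
Proof. by rewrite !fmap1. Qed.

Fact comp_functorM (a b c : C) (g : hom b c) (f : hom a b) :
  fmap G (fmap F (g \o f)) = fmap G (fmap F g) \o fmap G (fmap F f).
Proof. by rewrite !fmapM. Qed.

Definition comp_functor : functor C E :=
  @Functor C E (fun a => G (F a)) (fun _ _ f => fmap G (fmap F f))
    comp_functor1 comp_functorM.
End CompFunctor.

Definition naturally_isomorphic (C D : category) (F G : functor C D) : Prop :=
  exists t : forall a, hom (F a) (G a),
    (forall a b (f : hom a b), t b \o fmap F f = fmap G f \o t a)
    /\ forall a, is_iso (t a).

Definition is_equivalence (C D : category) (F : functor C D) : Prop :=
  exists G : functor D C,
    naturally_isomorphic (comp_functor G F) (id_functor C)
    /\ naturally_isomorphic (comp_functor F G) (id_functor D).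

Definition finite_category (J : category) : Prop :=
  finite_set [set: J] /\ forall a b : J, finite_set [set: hom a b].

Record cone (J C : category) (F : functor J C) := Cone {
  apex : C;
  leg : forall j, hom apex (F j);
  leg_natural : forall j k (u : hom j k), fmap F u \o leg j = leg k
}.

Record limit (J C : category) (F : functor J C) := Limit {
  limit_cone :> cone F;
  lift : forall d : cone F, hom (apex d) (apex limit_cone);
  leg_lift : forall (d : cone F) j, leg limit_cone j \o lift d = leg d j;
  lift_unique : forall (d : cone F) (h : hom (apex d) (apex limit_cone)),
    (forall j, leg limit_cone j \o h = leg d j) -> h = lift d
}.

(* A choice of limits; the theory below makes no assumption on the choice. *)
Definition finitely_complete (C : category) : Type :=
  forall (J : category) (F : functor J C), finite_category J -> limit F.

Section Thin.
Variables (T : Type) (r : rel T).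
Hypotheses (r_refl : reflexive r) (r_trans : transitive r).

Definition thin_category : category :=
  @Category T (fun a b => is_true (r a b)) r_refl
    (fun a b c bc ab => @r_trans b a c ab bc)
    (fun _ _ _ => bool_irrelevance _ _) (fun _ _ _ => bool_irrelevance _ _)
    (fun _ _ _ _ _ _ _ => bool_irrelevance _ _).
End Thin.

Lemma thin_category_finite (T : finType) (r : rel T) (rr : reflexive r)
  (rt : transitive r) : finite_category (thin_category rr rt).
Proof.
split=> [|a b]; first exact: finite_finset.
change (finite_set [set: is_true (r a b)]).
case: (r a b).
- suff -> : [set: is_true true]%classic = [set isT]%classic by exact: finite_set1.
  by apply/seteqP; split=> x _ //; exact: bool_irrelevance.
- suff -> : [set: is_true false]%classic = set0 by exact: finite_set0.
  by apply/seteqP; split=> x.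
Qed.

Definition empty_category : category :=
  @thin_category void (fun _ _ => true) (fun _ => isT) (fun _ _ _ _ _ => isT).

(* The category [Some true -> None <- Some false]. *)
Definition cospan_rel : rel (option bool) := fun a b => (b == None) || (a == b).

Fact cospan_rel_refl : reflexive cospan_rel.
Proof. by move=> [[]|]. Qed.

Fact cospan_rel_trans : transitive cospan_rel.
Proof. by move=> [[]|] [[]|] [[]|]. Qed.

Definition cospan_category : category :=
  thin_category cospan_rel_refl cospan_rel_trans.

Section Terminal.
Variables (C : category) (L : finitely_complete C).

Definition empty_map (v w : void) (_ : @hom empty_category v w) :
  hom (of_void C v) (of_void C w) := match v with end.

Fact empty_map1 (v : empty_category) :
  empty_map (idm v) = idm (of_void C v).
Proof. by case: v. Qed.

Fact empty_mapM (u v w : empty_category) (g : hom v w) (f : hom u v) :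
  empty_map (g \o f) = empty_map g \o empty_map f.
Proof. by case: u f. Qed.

Definition empty_functor : functor empty_category C :=
  @Functor empty_category C (of_void C) empty_map empty_map1 empty_mapM.

Definition terminal_limit : limit empty_functor :=
  L empty_functor (thin_category_finite _ _).

Definition one : C := apex terminal_limit.

Definition empty_leg (a : C) (v : void) : hom a (of_void C v) :=
  match v with end.

Fact empty_leg_natural (a : C) (v w : empty_category) (u : hom v w) :
  fmap empty_functor u \o empty_leg a v = empty_leg a w.
Proof. by case: v u. Qed.

Definition empty_cone (a : C) : cone empty_functor :=
  @Cone _ _ empty_functor a (empty_leg a) (@empty_leg_natural a).

Definition bang (a : C) : hom a one := lift terminal_limit (empty_cone a).

Lemma bang_unique (a : C) (f : hom a one) : f = bang a.
Proof. by apply: (lift_unique (l := terminal_limit) (d := empty_cone a)) => -[]. Qed.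
End Terminal.

Definition is_pullback (C : category) (a b c p : C)
    (f : hom a c) (g : hom b c) (p1 : hom p a) (p2 : hom p b) : Prop :=
  f \o p1 = g \o p2 /\
  forall (d : C) (u : hom d a) (v : hom d b), f \o u = g \o v ->
    exists! h : hom d p, p1 \o h = u /\ p2 \o h = v.

Section Pullback.
Variables (C : category) (L : finitely_complete C).
Variables (a b c : C) (f : hom a c) (g : hom b c).

Definition cospan_obj (j : option bool) : C :=
  match j with Some true => a | Some false => b | None => c end.

Definition cospan_map (j k : option bool) :
    cospan_rel j k -> hom (cospan_obj j) (cospan_obj k) :=
  match j, k return cospan_rel j k -> hom (cospan_obj j) (cospan_obj k) with
  | Some true, None => fun _ => f
  | Some false, None => fun _ => g
  | Some true, Some true => fun _ => idm a
  | Some false, Some false => fun _ => idm b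
  | None, None => fun _ => idm c
  | Some true, Some false | Some false, Some true
  | None, Some true | None, Some false =>
      fun h => False_rect _ (notF h)
  end.

Fact cospan_map1 (j : cospan_category) : cospan_map (idm j) = idm (cospan_obj j).
Proof. by case: j => [[]|]. Qed.

Fact cospan_mapM (i j k : cospan_category) (v : hom j k) (u : hom i j) :
  cospan_map (v \o u) = cospan_map v \o cospan_map u.
Proof.
move: i j k v u => [[]|] [[]|] [[]|] v u //=;
  by rewrite ?comp1m ?compm1 //; case: (notF u) || case: (notF v).
Qed.

Definition cospan_functor : functor cospan_category C :=
  @Functor cospan_category C cospan_obj cospan_map cospan_map1 cospan_mapM.

Definition pullback_limit : limit cospan_functor :=
  L cospan_functor (thin_category_finite _ _).

Definition pb : C := apex pullback_limit.
Definition pb1 : hom pb a := leg pullback_limit (Some true).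
Definition pb2 : hom pb b := leg pullback_limit (Some false).

Lemma pb_square : f \o pb1 = g \o pb2.
Proof.
have e1 := leg_natural pullback_limit
  (j := Some true : cospan_category) (k := None : cospan_category) isT.
have e2 := leg_natural pullback_limit
  (j := Some false : cospan_category) (k := None : cospan_category) isT.
exact: (etrans e1 (esym e2)).
Qed.

Section Lift.
Variables (d : C) (u : hom d a) (v : hom d b) (e : f \o u = g \o v).

Definition span_leg (j : option bool) : hom d (cospan_obj j) :=
  match j with Some true => u | Some false => v | None => f \o u end.

Fact span_leg_natural (j k : cospan_category) (w : hom j k) :
  fmap cospan_functor w \o span_leg j = span_leg k.
Proof.
move: j k w => [[]|] [[]|] w //=; rewrite ?comp1m //; by case: (notF w).
Qed.

Definition span_cone : cone cospan_functor :=
  @Cone _ _ cospan_functor d span_leg span_leg_natural.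

Definition pb_lift : hom d pb := lift pullback_limit span_cone.

Lemma pb1_lift : pb1 \o pb_lift = u.
Proof. exact: (leg_lift pullback_limit span_cone (Some true)). Qed.

Lemma pb2_lift : pb2 \o pb_lift = v.
Proof. exact: (leg_lift pullback_limit span_cone (Some false)). Qed.

Lemma pb_lift_unique (h : hom d pb) :
  pb1 \o h = u -> pb2 \o h = v -> h = pb_lift.
Proof.
move=> hu hv; apply: (lift_unique (l := pullback_limit) (d := span_cone)) => -[[]|] //=.
have <- : f \o pb1 = leg pullback_limit None.
  exact: (leg_natural pullback_limit
    (j := Some true : cospan_category) (k := None : cospan_category) isT).
by rewrite -compA hu.
Qed.
End Lift.

Lemma pb_ext (d : C) (h k : hom d pb) :
  pb1 \o h = pb1 \o k -> pb2 \o h = pb2 \o k -> h = k.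
Proof.
move=> e1 e2.
have e : f \o (pb1 \o k) = g \o (pb2 \o k) by rewrite !compA pb_square.
by rewrite (pb_lift_unique e e1 e2); apply/esym/pb_lift_unique.
Qed.

Lemma pb_is_pullback : is_pullback f g pb1 pb2.
Proof.
split=> [|d u v e]; first exact: pb_square.
exists (pb_lift e); split; first by rewrite pb1_lift pb2_lift.
by move=> h [hu hv]; apply/esym/pb_lift_unique.
Qed.
End Pullback.

Section Slice.
Variables (C : category) (x : C).

Record slice_obj := SliceObj { slice_dom : C; slice_map : hom slice_dom x }.

Definition slice_hom (a b : slice_obj) : Type :=
  {h : hom (slice_dom a) (slice_dom b) | slice_map b \o h = slice_map a}.

Definition slice_id (a : slice_obj) : slice_hom a a :=
  exist _ (idm (slice_dom a)) (compm1 (slice_map a)).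

Fact slice_comp_subproof (a b c : slice_obj)
  (g : slice_hom b c) (f : slice_hom a b) :
  slice_map c \o (sval g \o sval f) = slice_map a.
Proof. by rewrite compA (svalP g) (svalP f). Qed.

Definition slice_comp (a b c : slice_obj)
    (g : slice_hom b c) (f : slice_hom a b) : slice_hom a c :=
  exist _ (sval g \o sval f) (slice_comp_subproof g f).

Lemma slice_hom_eq (a b : slice_obj) (f g : slice_hom a b) :
  sval f = sval g -> f = g.
Proof. by case: f g => [f ef] [g eg] /=; exact: eq_exist. Qed.

Fact slice_comp1m (a b : slice_obj) (f : slice_hom a b) :
  slice_comp (slice_id b) f = f.
Proof. exact/slice_hom_eq/comp1m. Qed.

Fact slice_compm1 (a b : slice_obj) (f : slice_hom a b) :
  slice_comp f (slice_id a) = f.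
Proof. exact/slice_hom_eq/compm1. Qed.

Fact slice_compA (a b c d : slice_obj)
  (h : slice_hom c d) (g : slice_hom b c) (f : slice_hom a b) :
  slice_comp h (slice_comp g f) = slice_comp (slice_comp h g) f.
Proof. exact/slice_hom_eq/compA. Qed.

Definition slice : category :=
  Category slice_comp1m slice_compm1 slice_compA.
End Slice.

Definition full_subcategory (C : category) (P : C -> Prop) : category :=
  @Category {a : C | P a} (fun a b => hom (sval a) (sval b))
    (fun a => idm (sval a)) (fun _ _ _ g f => g \o f)
    (fun _ _ f => comp1m f) (fun _ _ f => compm1 f)
    (fun _ _ _ _ h g f => compA h g f).

Definition restrict_functor (C D : category) (P : C -> Prop) (Q : D -> Prop)
    (F : functor C D) (PQ : forall a, P a -> Q (F a)) :
    functor (full_subcategory P) (full_subcategory Q) :=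
  @Functor (full_subcategory P) (full_subcategory Q)
    (fun a => exist _ (F (sval a)) (PQ _ (svalP a)))
    (fun a b f => fmap F f) (fun a => fmap1 F (sval a))
    (fun _ _ _ g f => fmapM F g f).

Section PullbackFunctor.
Variables (C : category) (L : finitely_complete C) (x y : C) (f : hom x y).

Definition pullback_obj (a : slice y) : slice x :=
  SliceObj (pb2 L (slice_map a) f).

Fact pullback_map_subproof (a b : slice y) (h : hom a b) :
  slice_map b \o (sval h \o pb1 L (slice_map a) f) = f \o pb2 L (slice_map a) f.
Proof. by rewrite compA (svalP h) pb_square. Qed.

Definition pullback_map (a b : slice y) (h : hom a b) :
    hom (pullback_obj a) (pullback_obj b) :=
  exist _ (pb_lift L (pullback_map_subproof h))
    (pb2_lift L (pullback_map_subproof h)).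

Fact pullback_map1 (a : slice y) : pullback_map (idm a) = idm (pullback_obj a).
Proof.
apply: slice_hom_eq; apply: (@pb_ext _ L) => /=.
- by rewrite pb1_lift comp1m compm1.
- by rewrite pb2_lift compm1.
Qed.

Fact pullback_mapM (a b c : slice y) (h : hom b c) (k : hom a b) :
  pullback_map (h \o k) = pullback_map h \o pullback_map k.
Proof.
apply: slice_hom_eq; apply: (@pb_ext _ L) => /=.
- by rewrite pb1_lift compA pb1_lift -!compA pb1_lift.
- by rewrite pb2_lift compA !pb2_lift.
Qed.

Definition pullback_functor : functor (slice y) (slice x) :=
  Functor pullback_map1 pullback_mapM.
End PullbackFunctor.

Definition morphism_class (C : category) : Type :=
  forall a b : C, hom a b -> Prop.

Definition orthogonal (C : category) (a b c d : C)
    (e : hom a b) (m : hom c d) : Prop :=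
  forall (u : hom a c) (v : hom b d), m \o u = v \o e ->
    exists! w : hom b c, w \o e = u /\ m \o w = v.

Definition is_factorization (C : category) (E M : morphism_class C)
    (a b c : C) (f : hom a c) (e : hom a b) (m : hom b c) : Prop :=
  [/\ E a b e, M b c m & m \o e = f].

(* Freyd-Kelly: E and M determine each other by orthogonality; in particular
   both contain the isomorphisms and are closed under composition. *)
Record factorization_system (C : category) (E M : morphism_class C) : Prop :=
  FactorizationSystem {
    left_classE : forall (a b : C) (e : hom a b), E a b e <->
      forall (c d : C) (m : hom c d), M c d m -> orthogonal e m;
    right_classE : forall (c d : C) (m : hom c d), M c d m <->
      forall (a b : C) (e : hom a b), E a b e -> orthogonal e m;
    factorization_exists : forall (a c : C) (f : hom a c),
      exists (b : C) (e : hom a b) (m : hom b c), is_factorization E M f e m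
  }.

Lemma right_class_pullback (C : category) (E M : morphism_class C)
    (S : factorization_system E M) (a b c p : C)
    (f : hom a c) (g : hom b c) (p1 : hom p a) (p2 : hom p b) :
  is_pullback f g p1 p2 -> M a c f -> M p b p2.
Proof.
move=> [sq univ] Mf; apply/(right_classE S) => i j e Ee u v uv.
have [|w [[we fw] wu]] := (right_classE S f).1 Mf _ _ e Ee (p1 \o u) (g \o v).
  by rewrite compA sq -!compA uv.
have [h [[h1 h2] hu]] := univ _ _ _ fw.
have [k [_ ku]] := univ i (p1 \o u) (p2 \o u) (ltac:(by rewrite !compA sq)).
exists h; split.
  split=> //; rewrite -(ku (h \o e)) ?(ku u) //.
  by rewrite !compA h1 h2 we uv.
move=> h' [he hv]; apply: hu; split=> //; apply/esym/wu; split.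
- by rewrite -compA he.
- by rewrite compA sq -compA hv.
Qed.

Definition stable_along (C : category) (E N : morphism_class C) : Prop :=
  forall (a b c p : C) (e : hom a c) (n : hom b c)
    (p1 : hom p a) (p2 : hom p b),
    is_pullback e n p1 p2 -> E a c e -> N b c n -> E p b p2.

Record balanced_factorization_category := BalancedFactorizationCategory {
  bfc_category :> category;
  bfc_complete : finitely_complete bfc_category;
  bfcE : morphism_class bfc_category;
  bfcM : morphism_class bfc_category;
  bfcE' : morphism_class bfc_category;
  bfcM' : morphism_class bfc_category;
  bfc_fs : factorization_system bfcE bfcM;
  bfc_fs' : factorization_system bfcE' bfcM';
  reciprocal_stability : stable_along bfcE bfcM';
  reciprocal_stability' : stable_along bfcE' bfcM
}.
Arguments bfc_complete : clear implicits.

Section FiniteCoverings.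
Variable T : balanced_factorization_category.

Definition point (x : T) : Type := hom (one (bfc_complete T)) x.

Definition finite_covering (a x : T) (f : hom a x) : Prop :=
  bfcM f /\ bfcM' f.

Definition slice_covering (x : T) (a : slice x) : Prop :=
  finite_covering (slice_map a).

Definition coverings (x : T) : category :=
  full_subcategory (@slice_covering x).

Definition finite_sets : category := coverings (one (bfc_complete T)).

Lemma slice_covering_pullback (x y : T) (f : hom x y) (a : slice y) :
  slice_covering a ->
  slice_covering (pullback_functor (bfc_complete T) f a).
Proof.
move=> [Ma Ma']; have P := pb_is_pullback (bfc_complete T) (slice_map a) f.
split.
- exact: (right_class_pullback (bfc_fs T) P).
- exact: (right_class_pullback (bfc_fs' T) P).
Qed.

Definition covering_pullback (x y : T) (f : hom x y) :
    functor (coverings y) (coverings x) :=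
  restrict_functor (@slice_covering_pullback x y f).

Definition simply_connected (i : T) : Prop :=
  is_equivalence (covering_pullback (bang (bfc_complete T) i)).

(* Factorizations are unique only up to isomorphism, so X/x -> X is any second
   factor [m : a -> x] of an (E,M)-factorization of the point. *)
Definition is_point_slice (x : T) (p : point x) (a : T) (m : hom a x) : Prop :=
  exists e : point a, is_factorization (@bfcE T) (@bfcM T) p e m.

Definition locally_simply_connected (x : T) : Prop :=
  forall (p : point x) (a : T) (m : hom a x),
    is_point_slice p m -> simply_connected a.

Definition constant_covering (i : T) (b : coverings i) : Prop :=
  exists S : finite_sets,
    isomorphic b (covering_pullback (bang (bfc_complete T) i) S).

Definition locally_trivial (x : T) (b : coverings x) : Prop :=
  forall (p : point x) (a : T) (m : hom a x),
    is_point_slice p m -> constant_covering (covering_pullback m b).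
End FiniteCoverings.

(* Main.v *)
From mathcomp Require Import all_boot boolp.
Require Import Defs.

(** The object [X/x] carries a point [1 -> X/x] in [E], and any map [f] with a
    section [s] in [E] induces an equivalence on coverings, with inverse [s^*].
    Indeed [s^* f^*] is the identity because [f s = 1]; and for a covering [b]
    of the domain of [f], reciprocal stability along the coverings [b] and
    [f^* s^* b] puts both pullbacks of [s] in [E], so that [b] and [f^* s^* b]
    are the second factors of two (E,M)-factorizations of the same map. *)

Set Implicit Arguments.
Unset Strict Implicit.
Unset Printing Implicit Defensive.

Local Open Scope cat_scope.

Lemma is_pullback_sym (C : category) (a b c p : C)
    (f : hom a c) (g : hom b c) (p1 : hom p a) (p2 : hom p b) :
  is_pullback f g p1 p2 -> is_pullback g f p2 p1.
Proof.
move=> [sq univ]; split=> [|d u v uv]; first exact/esym.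
have [h [[h1 h2] hu]] := univ d v u (esym uv).
by exists h; split=> // k [k2 k1]; apply: hu.
Qed.

(** Both maps fill the square with top [w \o e] and bottom [m \o w]. *)
Lemma orthogonal_filler_unique (C : category) (a b c d : C)
    (e : hom a b) (m : hom c d) (w w' : hom b c) :
  orthogonal e m -> w \o e = w' \o e -> m \o w = m \o w' -> w = w'.
Proof.
move=> em we mw.
have [|k [_ ku]] := em (w \o e) (m \o w); first by rewrite compA.
by rewrite -(ku w) // -(ku w').
Qed.

(** The inverse is the filler of the square from [e'] to [m]; each composite is then the identity by
    uniqueness of fillers. *)
Lemma orthogonal_filler_iso (C : category) (a b b' c : C)
    (e : hom a b) (m : hom b c) (e' : hom a b') (m' : hom b' c)
    (w : hom b b') :
  orthogonal e m -> orthogonal e' m -> orthogonal e' m' ->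
  w \o e = e' -> m' \o w = m -> is_iso w.
Proof.
move=> em e'm e'm' we mw.
have [|g [[ge mg] _]] := e'm e m'; first by rewrite -we compA mw.
exists g; split.
- by apply: (orthogonal_filler_unique em); rewrite ?comp1m ?compm1 -?compA ?we // compA mg.
- by apply: (orthogonal_filler_unique e'm'); rewrite ?comp1m ?compm1 -?compA ?ge // compA mw.
Qed.

Lemma slice_is_iso (C : category) (x : C) (a b : slice x) (h : hom a b) :
  is_iso (sval h) -> is_iso h.
Proof.
move=> [g [gh hg]].
have gE : slice_map a \o g = slice_map b.
  by rewrite -(svalP h) -compA hg compm1.
exists (exist _ g gE : slice_hom b a); split; exact: slice_hom_eq.
Qed.

Lemma isomorphic_sym (C : category) (a b : C) :
  isomorphic a b -> isomorphic b a.
Proof. by move=> [f [g [gf fg]]]; exists g, f. Qed.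

Lemma equivalence_essentially_surjective (C D : category) (F : functor C D) :
  is_equivalence F -> forall d, exists c, isomorphic d (F c).
Proof.
move=> [G [_ [t [_ t_iso]]]] d; exists (G d).
by apply: isomorphic_sym; exists (t d); exact: t_iso.
Qed.

Section SectionInE.
Variables (T : balanced_factorization_category) (x y : T).
Variables (f : hom x y) (s : hom y x).
Hypotheses (fs : f \o s = idm y) (Es : bfcE s).

Let L := bfc_complete T.

Section RetractionUnit.
Variable a : coverings y.
Let b : coverings y := covering_pullback s (covering_pullback f a).

Fact retract_map_subproof :
  slice_map (sval a) \o (pb1 L (slice_map (sval a)) f \o
    pb1 L (pb2 L (slice_map (sval a)) f) s) = slice_map (sval b).
Proof. by rewrite compA pb_square -compA pb_square compA fs comp1m. Qed.

(** The composite of projections [s^* f^* a -> f^* a -> a]; it lies over [y] because [f \o s] is the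
    identity. *)
Definition retract_map : hom b a :=
  exist (fun h => slice_map (sval a) \o h = slice_map (sval b))
    _ retract_map_subproof.

Lemma retract_map_iso : is_iso retract_map.
Proof.
apply: (@slice_is_iso _ _ (sval b) (sval a)).
(* With [q] the structure map of [a], the inverse sends an element [z] to [((z, s (q z)), q z)]:
   [e1] gives the inner pair, [e2] the outer one. *)
have e1 : slice_map (sval a) \o idm _ = f \o (s \o slice_map (sval a)).
  by rewrite compm1 compA fs comp1m.
have e2 : pb2 L (slice_map (sval a)) f \o pb_lift L e1 = s \o slice_map (sval a).
  exact: pb2_lift.
exists (pb_lift L e2); split; rewrite /=; last first.
  by rewrite -compA pb1_lift pb1_lift.
apply: (@pb_ext _ L); last first.
  by rewrite compA pb2_lift retract_map_subproof compm1.
rewrite compA pb1_lift compm1; apply: (@pb_ext _ L).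
  by rewrite compA pb1_lift comp1m.
by rewrite compA pb2_lift -compA retract_map_subproof -pb_square.
Qed.
End RetractionUnit.

Lemma covering_pullback_retraction :
  naturally_isomorphic
    (comp_functor (covering_pullback s) (covering_pullback f))
    (id_functor (coverings y)).
Proof.
exists retract_map; split=> [a b h|]; last exact: retract_map_iso.
by apply: slice_hom_eq; rewrite /= -compA pb1_lift !compA pb1_lift.
Qed.

Section SectionCounit.
Variable b : coverings x.
Let sb := covering_pullback s b.
Let fsb := covering_pullback f sb.

Fact section_map_subproof :
  slice_map (sval sb) \o idm _ = f \o (s \o slice_map (sval sb)).
Proof. by rewrite compm1 compA fs comp1m. Qed.

(** In elements, [z] goes to [(z, s (q z))] with [q] the structure map of [s^* b]. *)
Definition section_map : hom (slice_dom (sval sb)) (slice_dom (sval fsb)) :=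
  pb_lift L section_map_subproof.

Lemma pb1_section_map : pb1 L (slice_map (sval sb)) f \o section_map = idm _.
Proof. exact: pb1_lift. Qed.

Lemma slice_map_section_map :
  slice_map (sval fsb) \o section_map = s \o slice_map (sval sb).
Proof. exact: pb2_lift. Qed.

(** Pasting this square with the one defining [f^* s^* b] gives a pullback along [f \o s], an
    identity. This exhibits [section_map] as a base change of [s] along a covering. *)
Lemma section_map_pullback :
  is_pullback s (slice_map (sval fsb)) (slice_map (sval sb)) section_map.
Proof.
split=> [|d u v uv]; first by rewrite slice_map_section_map.
(* This choice is forced, since [section_map] is a section of the first projection. *)
pose h := pb1 L (slice_map (sval sb)) f \o v.
have hu : slice_map (sval sb) \o h = u.
  by rewrite /h compA pb_square -compA -[_ \o v]uv compA fs comp1m.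
exists h; split; first split=> //.
  apply: (@pb_ext _ L); first by rewrite compA pb1_section_map comp1m.
  by rewrite compA [_ \o section_map]slice_map_section_map -compA hu.
by move=> k [_ kv]; rewrite /h -kv compA pb1_section_map comp1m.
Qed.

Lemma section_map_E : bfcE section_map.
Proof.
exact: (reciprocal_stability section_map_pullback Es (svalP fsb).2).
Qed.

Lemma pb1_section_E : bfcE (pb1 L (slice_map (sval b)) s).
Proof.
apply: (reciprocal_stability _ Es (svalP b).2).
exact/is_pullback_sym/pb_is_pullback.
Qed.

(** The isomorphism compares two factorizations of [s \o slice_map (sval sb)]. It is produced as
    data, by choice, to serve as a component of a transformation; the equation kept with it later
    yields naturality. *)
Lemma section_counit_exists :
  {h : hom fsb b | is_iso h &
     sval h \o section_map = pb1 L (slice_map (sval b)) s}.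
Proof.
apply: cid2.
have orth z w (e : hom z w) (c : coverings x) :
    bfcE e -> orthogonal e (slice_map (sval c)).
  by move=> Ee; apply: ((left_classE (bfc_fs T) e).1 Ee); case: (svalP c).
have [|w [[ws bw] _]] := orth _ _ _ b section_map_E
  (pb1 L (slice_map (sval b)) s) (slice_map (sval fsb)).
  by rewrite slice_map_section_map pb_square.
exists (exist _ w bw : slice_hom (sval fsb) (sval b)) => //.
apply: (@slice_is_iso _ _ (sval fsb) (sval b)).
exact: (orthogonal_filler_iso (orth _ _ _ fsb section_map_E)
  (orth _ _ _ fsb pb1_section_E) (orth _ _ _ b pb1_section_E) ws bw).
Qed.

Definition section_counit : hom fsb b := s2val section_counit_exists.

Lemma section_counit_iso : is_iso section_counit.
Proof. exact: (s2valP section_counit_exists). Qed.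

Lemma section_counit_section_map :
  sval section_counit \o section_map = pb1 L (slice_map (sval b)) s.
Proof. exact: (s2valP' section_counit_exists). Qed.
End SectionCounit.

Lemma section_map_natural (b c : coverings x) (h : hom b c) :
  sval (fmap (covering_pullback f) (fmap (covering_pullback s) h))
    \o section_map b =
  section_map c \o sval (fmap (covering_pullback s) h).
Proof.
apply: (@pb_ext _ L); rewrite !compA.
  by rewrite pb1_section_map pb1_lift -compA pb1_section_map comp1m compm1.
rewrite pb2_lift [in RHS]slice_map_section_map [LHS]slice_map_section_map.
by rewrite -compA; congr (_ \o _); rewrite [RHS]pb2_lift.
Qed.

Lemma covering_pullback_section :
  naturally_isomorphic
    (comp_functor (covering_pullback f) (covering_pullback s))
    (id_functor (coverings x)).
Proof.
exists section_counit; split=> [b c h|]; last exact: section_counit_iso.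
have orth : orthogonal (section_map b) (slice_map (sval c)).
  by apply: ((left_classE (bfc_fs T) _).1 (section_map_E b)); case: (svalP c).
(* The two sides of the naturality square agree after composing with [section_map b], where both
   become [h] after the first projection, and with the structure map of [c]. *)
apply: slice_hom_eq; apply: (orthogonal_filler_unique orth) => /=.
- rewrite -compA section_map_natural compA section_counit_section_map.
  by rewrite -compA section_counit_section_map [LHS]pb1_lift.
- rewrite !compA (svalP h) (svalP (section_counit b)).
  by rewrite (svalP (section_counit c)) [LHS]pb2_lift.
Qed.

Lemma covering_pullback_equivalence : is_equivalence (covering_pullback f).
Proof.
exists (covering_pullback s).
by split; [exact: covering_pullback_retraction|exact: covering_pullback_section].
Qed.
End SectionInE.

(** The first factor [e] of the point is a section in [E] of the map to [one], as [one] has a single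
    endomorphism. *)
Lemma point_slice_simply_connected (T : balanced_factorization_category)
    (x : T) (p : point x) (a : T) (m : hom a x) :
  is_point_slice p m -> simply_connected a.
Proof.
move=> [e [Ee _ _]]; apply: (covering_pullback_equivalence _ Ee).
by rewrite (bang_unique (_ \o _)) -(bang_unique (idm _)).
Qed.

Theorem corollary13p8 (T : balanced_factorization_category) (X : T) :
  locally_simply_connected X
  /\ forall b : coverings X, locally_trivial b.
Proof.
split=> [p a m|b p a m] pm; first exact: point_slice_simply_connected pm.
(* Constancy of [m^* b] says that it is in the essential image of pullback along the map to
   [one]. *)
apply: equivalence_essentially_surjective.
exact: point_slice_simply_connected pm.
Qed.
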